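(* Let $\mathcal G$ be an o-minimalistic expansion of an ordered group. Then the group is divisible and commutative, and it has no proper, non-trivial definable subgroups.
   Context: Let $L$ be a first-order language containing a binary relation symbol $<$; all $L$-structures are assumed to be dense linear orders without endpoints. Definable means definable with parameters. An $L$-structure is o-minimal if every definable subset of its universe is a finite union of points and open intervals. An $L$-structure is o-minimalistic if it satisfies every $L$-sentence that holds in every o-minimal $L$-structure. An expansion of an ordered group is a structure whose language contains $<$ and the group operation and whose reduct to these is a (not a priori commutative) ordered group. *)

(* Defs.v *)
From mathcomp Require Import all_boot.

Set Implicit Arguments.
Unset Strict Implicit.
Unset Printing Implicit Defensive.

Section Orders.
Variables (T : Type) (lt : T -> T -> Prop).

Definition linear_order : Prop :=
  [/\ forall x, ~ lt x x,
      forall x y z, lt x y -> lt y z -> lt x z &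
      forall x y, [\/ lt x y, x = y | lt y x]].

Definition dense_order : Prop := forall x y, lt x y -> exists z, lt x z /\ lt z y.

Definition no_endpoints : Prop :=
  forall x, (exists y, lt y x) /\ (exists y, lt x y).

End Orders.

Section Groups.
Variables (T : Type) (op : T -> T -> T).

Definition is_identity (e : T) : Prop := forall x, op e x = x /\ op x e = x.

Definition is_group : Prop :=
  associative op /\
  exists e, is_identity e /\ forall x, exists y, op x y = e /\ op y x = e.

(* The group is not assumed commutative, so both translations are required to be
   increasing. *)
Definition ordered_group (lt : T -> T -> Prop) : Prop :=
  [/\ linear_order lt, is_group &
      forall x y z, lt x y -> lt (op z x) (op z y) /\ lt (op x z) (op y z)].

(* For n > 0, [iterop n op y y] is the n-th power of y. *)
Definition divisible : Prop :=
  forall n, 0 < n -> forall x, exists y, iterop n op y y = x.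

(* The third clause is closure under inverses: y is the inverse of x. *)
Definition is_subgroup (H : T -> Prop) : Prop :=
  [/\ exists x, H x,
      forall x y, H x -> H y -> H (op x y) &
      forall x y, H x -> is_identity (op x y) -> H y].

Definition trivial_subset (H : T -> Prop) : Prop := forall x, H x <-> is_identity x.

Definition full_subset (H : T -> Prop) : Prop := forall x, H x.

End Groups.

(* [funsym k] and [relsym k] are the symbols of arity k; constants are the
   function symbols of arity 0. *)
Record language := Language {
  funsym : nat -> Type;
  relsym : nat -> Type;
  lt_sym : relsym 2
}.

Arguments lt_sym {_}.

(* Terms and formulas over L whose free variables are indexed by 'I_n. The
   quantifier [All] binds the variable 0 of its body, and the variable i of
   [All phi] is the variable i.+1 of phi. Satisfaction being classical, the
   other connectives and the existential quantifier are definable. *)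
Inductive term (L : language) (n : nat) : Type :=
| Var of 'I_n
| App k of funsym L k & ('I_k -> term L n).

Inductive formula (L : language) : nat -> Type :=
| Bot n : formula L n
| Eq n : term L n -> term L n -> formula L n
| Rel n k : relsym L k -> ('I_k -> term L n) -> formula L n
| Imp n : formula L n -> formula L n -> formula L n
| All n : formula L n.+1 -> formula L n.

Definition sentence (L : language) : Type := formula L 0.

Definition args2 (T : Type) (x y : T) : 'I_2 -> T := tnth [tuple x; y].

Record structure (L : language) := Structure {
  carrier :> Type;
  fun_interp : forall k, funsym L k -> ('I_k -> carrier) -> carrier;
  rel_interp : forall k, relsym L k -> ('I_k -> carrier) -> Prop;
  lt := fun x y => rel_interp lt_sym (args2 x y);
  structure_nonempty : inhabited carrier;
  lt_linear : linear_order lt;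
  lt_dense : dense_order lt;
  lt_no_endpoints : no_endpoints lt
}.

Section Semantics.
Variables (L : language) (M : structure L).

Definition binop (f : funsym L 2) (x y : M) : M := fun_interp f (args2 x y).

(* The assignment sending 0 to x and i.+1 to v i. *)
Definition scons n (x : M) (v : 'I_n -> M) : 'I_n.+1 -> M :=
  fun i => oapp v x (unlift ord0 i).

Fixpoint eval n (v : 'I_n -> M) (t : term L n) : M :=
  match t with
  | Var i => v i
  | App _ f ts => fun_interp f (fun j => eval v (ts j))
  end.

Fixpoint sat n (phi : formula L n) : ('I_n -> M) -> Prop :=
  match phi with
  | Bot _ => fun=> False
  | Eq _ s t => fun v => eval v s = eval v t
  | Rel _ _ r ts => fun v => rel_interp r (fun j => eval v (ts j))
  | Imp _ phi1 phi2 => fun v => sat phi1 v -> sat phi2 v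
  | All _ phi1 => fun v => forall x, sat phi1 (scons x v)
  end.

Definition models (phi : sentence L) : Prop := forall v : 'I_0 -> M, sat phi v.

Definition definable (S : M -> Prop) : Prop :=
  exists n (phi : formula L n.+1) (a : 'I_n -> M),
    forall x, S x <-> sat phi (scons x a).

(* In [Itv lo hi], the endpoint [None] stands for -oo on the left and for +oo
   on the right. *)
Inductive piece : Type :=
| Pt of M
| Itv of option M & option M.

Definition in_piece (p : piece) (x : M) : Prop :=
  match p with
  | Pt a => x = a
  | Itv lo hi => (if lo is Some a then lt a x else True) /\
                 (if hi is Some b then lt x b else True)
  end.

Definition o_minimal : Prop :=
  forall S, definable S ->
    exists n (p : 'I_n -> piece), forall x, S x <-> exists i, in_piece (p i) x.

End Semantics.

Definition o_minimalistic (L : language) (M : structure L) : Prop :=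
  forall phi : sentence L,
    (forall N : structure L, o_minimal N -> models N phi) -> models M phi.

(* Main.v *)
Require Import Defs.
From mathcomp Require Import all_boot.
From Stdlib Require Import Classical_Prop FunctionalExtensionality PropExtensionality.


(** Everything follows from one dichotomy: a definable subgroup of an
    o-minimalistic ordered group is trivial or full. Applied to the centralizer
    of an element a, which contains a, it gives commutativity; in a commutative
    group the n-th powers form a definable subgroup, which is not trivial
    because an ordered group is torsion-free, and so it gives divisibility.

    For a fixed formula phi, the dichotomy for the subgroups defined by phi with
    arbitrary parameters is a first-order sentence about the structure
    ([uniform_subgroup_dichotomy]). By the definition of o-minimalistic it is
    therefore enough to prove it in o-minimal structures, where definable sets
    are finite unions of points and intervals
    ([o_minimal_definable_subgroup]). Let H be a non-trivial subgroup of this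
    kind and h > 1 an element of it.
    - H is convex. If 1 < g < h and g is not in H, then H contains all powers
      of h but none of the elements h^k g, which separate consecutive powers.
      By the pigeonhole principle two powers of h lie in the same convex piece
      of H, and this piece also contains an element h^k g
      ([convex_union_subgroup_convex]).
    - If H is not full, convexity makes it bounded above. One of its finitely
      many pieces is cofinal in it ([finite_union_cofinal]), and the right end
      of that piece is a supremum s of H ([cofinal_piece_sup]). But some x in H
      exceeds s h^-1, so that x h is in H and exceeds s
      ([pos_subgroup_no_sup]).

    The first-order expressibility is handled semantically: [uniform P] says
    that one formula defines the predicate P on assignments in all structures
    at once. Such predicates are closed under the logical connectives,
    quantifiers and substitution of terms, so that formulas in de Bruijn style
    need not be written out. *)

Set Implicit Arguments.
Unset Strict Implicit.
Unset Printing Implicit Defensive.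

(** * Renaming the variables of a formula *)

Section Renaming.
Variable L : language.

Fixpoint rename_term n m (r : 'I_n -> 'I_m) (t : term L n) : term L m :=
  match t with
  | Var i => Var L (r i)
  | App _ f ts => App f (fun j => rename_term r (ts j))
  end.

Definition rename_lift n m (r : 'I_n -> 'I_m) (i : 'I_n.+1) : 'I_m.+1 :=
  oapp (fun j => lift ord0 (r j)) ord0 (unlift ord0 i).

Fixpoint rename n (phi : formula L n) : forall m, ('I_n -> 'I_m) -> formula L m :=
  match phi in formula _ n return forall m, ('I_n -> 'I_m) -> formula L m with
  | Bot _ => fun m _ => Bot L m
  | Eq _ s t => fun m r => Eq (rename_term r s) (rename_term r t)
  | Rel _ _ R ts => fun m r => Rel R (fun j => rename_term r (ts j))
  | Imp _ phi1 phi2 => fun m r => Imp (rename phi1 r) (rename phi2 r)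
  | All _ phi1 => fun m r => All (rename phi1 (rename_lift r))
  end.

Variable M : structure L.

Lemma scons_zero n (x : M) (v : 'I_n -> M) : scons x v ord0 = x.
Proof. by rewrite /scons unlift_none. Qed.

Lemma scons_succ n (x : M) (v : 'I_n -> M) i : scons x v (lift ord0 i) = v i.
Proof. by rewrite /scons liftK. Qed.

Lemma scons_eta n (v : 'I_n.+1 -> M) :
  scons (v ord0) (fun i => v (lift ord0 i)) = v.
Proof.
by apply: functional_extensionality => i; rewrite /scons; case: unliftP => [j|] ->.
Qed.

Lemma eval_rename n m (r : 'I_n -> 'I_m) (v : 'I_m -> M) (t : term L n) :
  eval v (rename_term r t) = eval (fun i => v (r i)) t.
Proof.
elim: t => [//|k f ts IH] /=.
by congr fun_interp; apply: functional_extensionality.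
Qed.

Lemma sat_rename n (phi : formula L n) m (r : 'I_n -> 'I_m) (v : 'I_m -> M) :
  sat (rename phi r) v <-> sat phi (fun i => v (r i)).
Proof.
elim: phi m r v => {n} [n|n s t|n k R ts|n phi IH psi IH'|n phi IH] m r v //=.
- by rewrite !eval_rename.
- suff -> : (fun j => eval v (rename_term r (ts j))) =
            (fun j => eval (fun i => v (r i)) (ts j)) by [].
  by apply: functional_extensionality => j; rewrite eval_rename.
- by split=> h /IH /h /IH'.
- suff E x : (fun i => scons x v (rename_lift r i)) = scons x (fun i => v (r i)).
    by split=> h x; have := h x; rewrite IH E.
  apply: functional_extensionality => i; rewrite /rename_lift.
  case: (unliftP ord0 i) => [j|] -> /=; first by rewrite !scons_succ.
  by rewrite !scons_zero.
Qed.

End Renaming.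

(** * Predicates definable by one formula in all structures *)

Section UniformDefinability.
Variable L : language.

(** The formula must not depend on the structure: this is what lets a fact
    travel from the o-minimal structures to an o-minimalistic one. *)
Definition uniform n (P : forall N : structure L, ('I_n -> N) -> Prop) : Prop :=
  exists phi : formula L n, forall N v, sat phi v <-> P N v.

Definition uniform_fun n (f : forall N : structure L, ('I_n -> N) -> N) : Prop :=
  exists t : term L n, forall N v, eval v t = f N v.

Lemma uniform_ext n (P Q : forall N : structure L, ('I_n -> N) -> Prop) :
  (forall N v, P N v <-> Q N v) -> uniform P -> uniform Q.
Proof. by move=> PQ [phi h]; exists phi => N v; rewrite h. Qed.

Lemma uniform_var n (i : 'I_n) : uniform_fun (fun N v => v i).
Proof. by exists (Var L i). Qed.

Lemma eval_args2 (N : structure L) n (v : 'I_n -> N) (s t : term L n) :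
  (fun j => eval v (args2 s t j)) = args2 (eval v s) (eval v t).
Proof.
apply: functional_extensionality => j; rewrite /args2 !(tnth_nth (eval v s)).
rewrite (tnth_nth s).
by case: j => [[|[|//]] ?].
Qed.

Lemma uniform_binop n (op : funsym L 2) f g :
  @uniform_fun n f -> @uniform_fun n g ->
  uniform_fun (fun N v => binop op (f N v) (g N v)).
Proof.
move=> [s hs] [t ht]; exists (App op (args2 s t)) => N v /=.
by rewrite eval_args2 hs ht.
Qed.

Lemma uniform_iterop n (op : funsym L 2) k f :
  0 < k -> @uniform_fun n f ->
  uniform_fun (fun N v => iterop k (@binop L N op) (f N v) (f N v)).
Proof.
case: k => // k _ hf; elim: k => [//|k IH].
exact: uniform_binop hf IH.
Qed.

Lemma uniform_eq n f g :
  @uniform_fun n f -> @uniform_fun n g -> uniform (fun N v => f N v = g N v).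
Proof. by move=> [s hs] [t ht]; exists (Eq s t) => N v /=; rewrite hs ht. Qed.

Lemma uniform_lt n f g :
  @uniform_fun n f -> @uniform_fun n g -> uniform (fun N v => lt (f N v) (g N v)).
Proof.
move=> [s hs] [t ht]; exists (Rel lt_sym (args2 s t)) => N v /=.
by rewrite eval_args2 hs ht.
Qed.

Lemma uniform_imp n P Q :
  @uniform n P -> @uniform n Q -> uniform (fun N v => P N v -> Q N v).
Proof.
move=> [phi hphi] [psi hpsi]; exists (Imp phi psi) => N v /=.
by rewrite hphi hpsi.
Qed.

Lemma uniform_not n P : @uniform n P -> uniform (fun N v => ~ P N v).
Proof. by move=> [phi hphi]; exists (Imp phi (Bot L n)) => N v /=; rewrite hphi. Qed.

(** Satisfaction is classical, so conjunction, disjunction and existence have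
    their usual classical encodings by implication, falsity and [All]. *)
Lemma uniform_and n P Q :
  @uniform n P -> @uniform n Q -> uniform (fun N v => P N v /\ Q N v).
Proof.
move=> hP hQ; apply: uniform_ext (uniform_not (uniform_imp hP (uniform_not hQ))).
by move=> N v; split=> [h|[p q] /(_ p q)//]; split; apply: NNPP => h'; apply: h.
Qed.

Lemma uniform_or n P Q :
  @uniform n P -> @uniform n Q -> uniform (fun N v => P N v \/ Q N v).
Proof.
move=> hP hQ; apply: uniform_ext (uniform_imp (uniform_not hP) hQ).
move=> N v; split=> [h|[p|q] //].
by case: (classic (P N v)) => [|/h]; [left|right].
Qed.

Lemma uniform_iff n P Q :
  @uniform n P -> @uniform n Q -> uniform (fun N v => P N v <-> Q N v).
Proof. by move=> hP hQ; apply: uniform_and; apply: uniform_imp. Qed.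

(** The quantified variable becomes the variable 0 of the body and the old
    variables are shifted; stating the premise with [w ord0] and the shifted
    tail lets the lemma be applied by unification with a quantified predicate. *)
Lemma uniform_forall n (Q : forall N : structure L, N -> ('I_n -> N) -> Prop) :
  uniform (fun N (w : 'I_n.+1 -> N) => Q N (w ord0) (fun i => w (lift ord0 i))) ->
  uniform (fun N v => forall x, Q N x v).
Proof.
move=> [phi hphi]; exists (All phi) => N v /=.
have E x : (fun i => scons x v (lift ord0 i)) = v.
  by apply: functional_extensionality => i; rewrite scons_succ.
by split=> h x; have := h x; rewrite hphi scons_zero E.
Qed.

Lemma uniform_exists n (Q : forall N : structure L, N -> ('I_n -> N) -> Prop) :
  uniform (fun N (w : 'I_n.+1 -> N) => Q N (w ord0) (fun i => w (lift ord0 i))) ->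
  uniform (fun N v => exists x, Q N x v).
Proof.
move=> hQ.
have := uniform_not (uniform_forall (Q := fun N x v => ~ Q N x v) (uniform_not hQ)).
apply: uniform_ext => N v; split=> [h|[x q] /(_ x)//].
by apply: NNPP => h'; apply: h => x q; apply: h'; exists x.
Qed.

Lemma uniform_fun_weaken n f :
  @uniform_fun n f ->
  uniform_fun (fun N (w : 'I_n.+1 -> N) => f N (fun i => w (lift ord0 i))).
Proof.
by move=> [t ht]; exists (rename_term (lift ord0) t) => N w; rewrite eval_rename ht.
Qed.

Lemma uniform_is_identity n (op : funsym L 2) f :
  @uniform_fun n f -> uniform (fun N v => is_identity (@binop L N op) (f N v)).
Proof.
move=> /uniform_fun_weaken hf; have hx := uniform_var (@ord0 n).
by apply: uniform_forall; apply: uniform_and; apply: uniform_eq => //;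
  exact: uniform_binop.
Qed.

(** At a variable, membership needs no more than a renaming of phi. *)
Lemma uniform_mem_var n m (phi : formula L n.+1) (i : 'I_m) (r : 'I_n -> 'I_m) :
  uniform (fun N v => sat phi (scons (v i) (fun j => v (r j)))).
Proof.
exists (rename phi (fun k => oapp r i (unlift ord0 k))) => N v.
rewrite sat_rename; set w := (fun k => _); set w' := scons _ _.
suff -> : w = w' by [].
apply: functional_extensionality => k; rewrite /w /w' /scons.
by case: (unlift ord0 k).
Qed.

(** Membership at a term is reduced to membership at a variable by quantifying
    over a variable equal to the term; this avoids substitution of terms in
    formulas. *)
Lemma uniform_mem n m (phi : formula L n.+1) (r : 'I_n -> 'I_m) f :
  uniform_fun f -> uniform (fun N v => sat phi (scons (f N v) (fun j => v (r j)))).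
Proof.
move=> /uniform_fun_weaken hf.
have hQ : uniform (fun N v => forall z, z = f N v -> sat phi (scons z (fun j => v (r j)))).
  apply: uniform_forall; apply: uniform_imp.
    by apply: uniform_eq => //; exact: uniform_var.
  exact: (uniform_mem_var phi ord0 (fun j => lift ord0 (r j))).
by apply: uniform_ext hQ => N v; split=> [/(_ _ erefl)//|h _ ->].
Qed.

(** The definition of o-minimalistic speaks of sentences only; free variables
    are dealt with by quantifying them universally one after the other. *)
Lemma o_minimalistic_transfer (M : structure L) n
    (P : forall N : structure L, ('I_n -> N) -> Prop) :
  o_minimalistic M -> uniform P ->
  (forall N v, o_minimal N -> P N v) -> forall v, P M v.
Proof.
move=> hM [phi hphi] hP v; rewrite -hphi.
have {P hphi hP} : forall (N : structure L) (v : 'I_n -> N), o_minimal N -> sat phi v.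
  by move=> N w hN; rewrite hphi; exact: hP.
elim: n phi v => [|n IH] phi v h; first by apply: hM => N hN w; exact: h.
have /= := IH (All phi) (fun i => v (lift ord0 i)).
by rewrite -{2}(scons_eta v); apply=> N w hN /= x; exact: h.
Qed.

Lemma uniform_definable (M : structure L) (S : M -> Prop) n
    (P : forall N : structure L, ('I_n.+1 -> N) -> Prop) (a : 'I_n -> M) :
  uniform P -> (forall x, S x <-> P M (scons x a)) -> definable S.
Proof. by move=> [phi hphi] hS; exists n, phi, a => x; rewrite hphi hS. Qed.

End UniformDefinability.

(** * Finite unions in a linear order *)

Lemma pigeonhole_nat n (P : nat -> 'I_n -> Prop) :
  (forall k, exists i, P k i) -> exists j k i, [/\ j < k, P j i & P k i].
Proof.
move=> hP.
have [f hf] := fin_all_exists (fun k : 'I_n.+1 => hP k).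
have /injectivePn [j [k jk fjk]] : ~~ injectiveb f.
  by apply/negP => /injectiveP /leq_card; rewrite !card_ord ltnn.
case: (ltngtP j k) => [ltjk|ltkj|/val_inj eqjk].
- by exists j, k, (f j); split=> //; rewrite fjk.
- by exists k, j, (f j); split=> //; rewrite fjk.
- by rewrite eqjk eqxx in jk.
Qed.

(** If no C i is cofinal in H, then every C i has a strict upper bound b i in H.
    As b i lies in some C (f i), we have b i < b (f i); iterating f on a finite
    index set would then produce a strictly increasing sequence that repeats. *)
Lemma finite_union_cofinal (T : Type) (lt : T -> T -> Prop) (H : T -> Prop) n
    (C : 'I_n -> T -> Prop) :
  linear_order lt -> (exists x, H x) -> (forall x, H x -> exists i, C i x) ->
  exists i, forall x, H x -> exists2 y, C i y & ~ lt y x.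
Proof.
move=> [irr tr _] [x0 Hx0] cover; apply: NNPP => nocof.
have /fin_all_exists [b hb] i : exists x, H x /\ forall y, C i y -> lt y x.
  apply: NNPP => nob; apply: nocof; exists i => x Hx.
  apply: NNPP => noy; apply: nob; exists x; split=> // y Cy.
  by apply: NNPP => nlt; apply: noy; exists y.
have [f hf] := fin_all_exists (fun i => cover _ (hb i).1).
have [i0 _] := cover _ Hx0.
have step k : lt (b (iter k f i0)) (b (iter k.+1 f i0)).
  exact: (hb _).2 (hf _).
have [j [k [_ [ltjk <- eq_b]]]] := pigeonhole_nat (P := fun k i => iter k f i0 = i)
  (fun k => ex_intro _ (iter k f i0) erefl).
suff : lt (b (iter j f i0)) (b (iter k f i0)) by rewrite eq_b; exact: irr.
elim: k ltjk {eq_b} => // k IH; rewrite ltnS leq_eqVlt => /orP [/eqP <- //|/IH h].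
exact: tr h (step k).
Qed.

(** * Subgroups of an ordered group *)

Section OrderedGroups.
Variables (T : Type) (op : T -> T -> T) (lt : T -> T -> Prop) (e : T).
Hypotheses (hog : ordered_group op lt) (he : is_identity op e).

Let opA : associative op. Proof. by case: hog => _ []. Qed.
Let op1x x : op e x = x. Proof. by case: (he x). Qed.
Let opx1 x : op x e = x. Proof. by case: (he x). Qed.
Let irr x : ~ lt x x. Proof. by case: hog => [[h _ _] _ _]. Qed.
Let tr x y z : lt x y -> lt y z -> lt x z.
Proof. by case: hog => [[_ h _] _ _]; exact: h. Qed.
Let tot x y : [\/ lt x y, x = y | lt y x].
Proof. by case: hog => [[_ _ h] _ _]. Qed.
Let ltl z x y : lt x y -> lt (op z x) (op z y).
Proof. by case: hog => _ _ h /(h _ _ z) []. Qed.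
Let ltr z x y : lt x y -> lt (op x z) (op y z).
Proof. by case: hog => _ _ h /(h _ _ z) []. Qed.

Lemma identity_uniq x : is_identity op x -> x = e.
Proof. by move=> hx; rewrite -(opx1 x) (hx e).1. Qed.

Lemma inverse_exists x : exists y, op x y = e /\ op y x = e.
Proof.
case: hog => _ [_ [e' [he' hinv]]] _; rewrite -(identity_uniq he').
exact: hinv.
Qed.

Lemma op_injl z x y : op z x = op z y -> x = y.
Proof.
by have [w [_ wz]] := inverse_exists z => /(congr1 (op w)); rewrite !opA wz !op1x.
Qed.

Definition pow n x := iter n (op x) e.

Lemma iterop_pow n x : 0 < n -> iterop n op x x = pow n x.
Proof. by case: n => // n _; rewrite iteropS /pow iterSr opx1. Qed.

Lemma pow_identity n : pow n e = e.
Proof. by elim: n => //= n ->; exact: op1x. Qed.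

Lemma powSr n x : pow n.+1 x = op (pow n x) x.
Proof.
elim: n => [|n IH] /=; first by rewrite op1x opx1.
by rewrite -opA -[op (iter n _ _) x]IH.
Qed.

Lemma pow_op n x y : commutative op -> pow n (op x y) = op (pow n x) (pow n y).
Proof.
move=> C; elim: n => [|n IH] /=; first by rewrite op1x.
by rewrite -/(pow n _) IH -!opA (opA y) (C y) -!opA.
Qed.

(** With j = 0 this is torsion-freeness: a positive element has positive powers. *)
Lemma pow_mono x j k : lt e x -> j < k -> lt (pow j x) (pow k x).
Proof.
move=> ex; have step m : lt (pow m x) (pow m.+1 x).
  by have := ltr (pow m x) ex; rewrite op1x.
elim: k => // k IH; rewrite ltnS leq_eqVlt => /orP [/eqP <- //|/IH h].
exact: tr h (step k).
Qed.

Lemma inverse_lt x y : lt x e -> op x y = e -> lt e y.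
Proof. by move=> xe xy; have := ltr y xe; rewrite xy op1x. Qed.

Lemma inverse_gt x y : lt e x -> op x y = e -> lt y e.
Proof. by move=> ex xy; have := ltr y ex; rewrite xy op1x. Qed.

Variable H : T -> Prop.
Hypothesis hH : is_subgroup op H.

Lemma subgroup_op x y : H x -> H y -> H (op x y).
Proof. by case: hH => _ h _; exact: h. Qed.

Lemma subgroup_inverse x y : H x -> op x y = e -> H y.
Proof. by case: hH => _ _ h Hx xy; apply: (h x) => //; rewrite xy. Qed.

Lemma subgroup_identity : H e.
Proof.
have [[x Hx] _ _] := hH; have [y [xy _]] := inverse_exists x.
by rewrite -xy; apply: subgroup_op => //; exact: subgroup_inverse xy.
Qed.

Lemma subgroup_pow n x : H x -> H (pow n x).
Proof.
move=> Hx; elim: n => [|n IH]; first exact: subgroup_identity.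
exact: subgroup_op.
Qed.

Lemma subgroup_cancel x y : H x -> H (op x y) -> H y.
Proof.
move=> Hx Hxy; have [z [xz zx]] := inverse_exists x.
by rewrite -(op1x y) -zx -opA; apply: subgroup_op => //; exact: subgroup_inverse xz.
Qed.

Lemma subgroup_trivial_or_pos : trivial_subset op H \/ exists2 h, H h & lt e h.
Proof.
case: (classic (exists2 h, H h & lt e h)) => [|npos]; [by right|left=> x].
split=> [Hx|/identity_uniq ->]; last exact: subgroup_identity.
case: (tot e x) => [ex|<- //|xe]; first by case: npos; exists x.
have [y [xy _]] := inverse_exists x.
by case: npos; exists y; [exact: subgroup_inverse xy|exact: inverse_lt xy].
Qed.

(** The powers h^k all lie in H, so two of them, h^j and h^k with j < k, lie in
    the same convex piece; h^j g lies between them, because g < h, and hence in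
    H. Cancelling h^j gives g in H. *)
Lemma convex_union_subgroup_convex n (C : 'I_n -> T -> Prop) :
  (forall i x y z, C i x -> C i z -> lt x y -> lt y z -> C i y) ->
  (forall x, H x <-> exists i, C i x) ->
  forall g h, H h -> lt e g -> lt g h -> H g.
Proof.
move=> convC HC g h Hh eg gh.
have [j [k [i [ltjk Cj Ck]]]] := pigeonhole_nat (P := fun k i => C i (pow k h))
  (fun k => (HC _).1 (subgroup_pow k Hh)).
apply: (subgroup_cancel (subgroup_pow j Hh)); apply/HC; exists i.
apply: (convC i (pow j h) _ (pow k h)) => //.
  by have := ltl (pow j h) eg; rewrite opx1.
have := ltl (pow j h) gh; rewrite -powSr => lt1.
move: ltjk; rewrite leq_eqVlt => /orP [/eqP <- //|lt2].
exact: tr lt1 (pow_mono (tr eg gh) lt2).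
Qed.

Lemma convex_subgroup_full_or_bounded :
  (forall g h, H h -> lt e g -> lt g h -> H g) ->
  full_subset H \/ exists g, forall x, H x -> lt x g.
Proof.
move=> conv; case: (classic (full_subset H)) => [|nfull]; [by left|right].
have [g Hg] : exists g, ~ H g.
  by apply: NNPP => h; apply: nfull => x; apply: NNPP => Hx; apply: h; exists x.
have [g' Hg' eg'] : exists2 g', ~ H g' & lt e g'.
  case: (tot e g) => [eg|eg|ge]; first by exists g.
    by case: Hg; rewrite -eg; exact: subgroup_identity.
  have [y [gy yg]] := inverse_exists g.
  exists y; last exact: inverse_lt gy.
  by move=> Hy; apply: Hg; exact: subgroup_inverse yg.
exists g' => x Hx; case: (tot x g') => [//|xg|gx]; first by case: Hg'; rewrite -xg.
by case: Hg'; exact: conv gx.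
Qed.

(** The translate s h^-1 is smaller than s, hence smaller than some x in H; then
    x h is an element of H above s. *)
Lemma pos_subgroup_no_sup h s :
  H h -> lt e h -> (forall x, H x -> ~ lt s x) ->
  ~ (forall c, lt c s -> exists2 x, H x & lt c x).
Proof.
move=> Hh eh ub lub; have [k [hk kh]] := inverse_exists h.
have [x Hx] : exists2 x, H x & lt (op s k) x.
  by apply: lub; have := ltl s (inverse_gt eh hk); rewrite opx1.
by move=> /(ltr h); rewrite -opA kh opx1; apply: ub; exact: subgroup_op.
Qed.

End OrderedGroups.

(** * Definable subgroups in o-minimal structures *)

Section OMinimal.
Variables (L : language) (N : structure L).

Lemma piece_convex (p : piece N) x y z :
  in_piece p x -> in_piece p z -> lt x y -> lt y z -> in_piece p y.
Proof.
have [irr tr _] := lt_linear N.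
case: p => [a|lo hi] /=; first by move=> -> -> h /(tr _ _ _ h) /irr.
move=> [lox _] [_ zhi] xy yz; split.
  by case: lo lox => // a ax; exact: tr ax xy.
by case: hi zhi => // b zb; exact: tr yz zb.
Qed.

(** The supremum is the right end of p. It exists because p cannot be unbounded
    to the right: otherwise p, and with it H, would contain the bound g. Density
    is what makes the right end b of an interval a least upper bound. *)
Lemma cofinal_piece_sup (H : N -> Prop) (p : piece N) g :
  (exists x, H x) -> (forall x, in_piece p x -> H x) ->
  (forall x, H x -> exists2 y, in_piece p y & ~ lt y x) ->
  (forall x, H x -> lt x g) ->
  exists s, (forall x, H x -> ~ lt s x) /\
            (forall c, lt c s -> exists2 x, H x & lt c x).
Proof.
have [irr tr tot] := lt_linear N.
move=> [x0 Hx0] pH cof bd; have [y0 py0 _] := cof _ Hx0.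
case: p pH cof py0 => [a|lo [b|]] pH cof py0 /=.
- exists a; split=> [x /cof [y ->]//|c ca]; exists a => //; exact: pH.
- exists b; split=> [x /cof [y [_ yb] nyx] bx|c cb]; first exact: nyx (tr _ _ _ yb bx).
  case: py0 => loy0 y0b.
  (* Any point of the interval above both c and y0 will do. *)
  case: (tot c y0) => [cy0|cy0|y0c]; first by exists y0 => //; exact: pH.
    have [z [cz zb]] := lt_dense cb; exists z => //; apply: (pH); split=> //.
    by case: lo loy0 {pH cof} => // a ay0; apply: tr ay0 _; rewrite -cy0.
  have [z [cz zb]] := lt_dense cb; exists z => //; apply: (pH); split=> //.
  by case: lo loy0 {pH cof} => // a ay0; exact: tr ay0 (tr _ _ _ y0c cz).
- case: (irr g); apply: (bd); apply: (pH); split=> //; case: py0 => loy0 _.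
  have y0g : lt y0 g by apply: bd; apply: (pH); split.
  by case: lo loy0 {pH cof} => // a ay0; exact: tr ay0 y0g.
Qed.

Lemma o_minimal_definable_subgroup (op : funsym L 2) (H : N -> Prop) :
  o_minimal N -> ordered_group (@binop L N op) (@lt L N) -> definable H ->
  is_subgroup (@binop L N op) H ->
  trivial_subset (@binop L N op) H \/ full_subset H.
Proof.
move=> omin hog /omin [n [p Hp]] hH.
have [_ [_ [e [he _]]] _] := hog.
have [|[h Hh eh]] := subgroup_trivial_or_pos hog he hH; [by left|right].
have conv := convex_union_subgroup_convex hog he hH (fun i => @piece_convex (p i)) Hp.
have [//|[g bd]] := convex_subgroup_full_or_bounded hog he hH conv.
have exH : exists x, H x by exists h.
have [i cof] := finite_union_cofinal (lt_linear N) exH (fun x => (Hp x).1).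
have pH x : in_piece (p i) x -> H x by move=> px; apply/Hp; exists i.
have [s [ub lub]] := cofinal_piece_sup exH pH cof bd.
by case: (pos_subgroup_no_sup hog he hH Hh eh ub lub).
Qed.

End OMinimal.

(** * The dichotomy as a first-order statement *)

(** The order axioms hold in every structure, so only the group axioms and
    monotonicity have to be expressed. *)
Lemma uniform_ordered_group (L : language) n (op : funsym L 2) :
  uniform (n := n) (fun N _ => ordered_group (@binop L N op) (@lt L N)).
Proof.
pose P (N : structure L) :=
  [/\ (forall x y z : N, binop op x (binop op y z) = binop op (binop op x y) z) &
      (exists e : N, is_identity (binop op) e /\
                 forall x, exists y, binop op x y = e /\ binop op y x = e) /\
      (forall x y z : N, lt x y -> lt (binop op z x) (binop op z y) /\
                                 lt (binop op x z) (binop op y z))].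
apply: (@uniform_ext L n (fun N _ => P N)).
  by move=> N _; split=> [[? [? ?]]|[_ [? ?] ?]]; split=> //; exact: lt_linear.
apply: uniform_and.
  by do 3 apply: uniform_forall; apply: uniform_eq; do ?[exact: uniform_var|apply: uniform_binop].
apply: uniform_and.
  apply: uniform_exists; apply: uniform_and.
    by apply: uniform_is_identity; exact: uniform_var.
  apply: uniform_forall; apply: uniform_exists.
  by apply: uniform_and; apply: uniform_eq; do ?[exact: uniform_var|apply: uniform_binop].
do 3 apply: uniform_forall; apply: uniform_imp.
  by apply: uniform_lt; exact: uniform_var.
by apply: uniform_and; apply: uniform_lt; do ?[exact: uniform_var|apply: uniform_binop].
Qed.

Lemma uniform_subgroup_dichotomy (L : language) n (op : funsym L 2)
    (phi : formula L n.+1) :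
  uniform (fun (N : structure L) v =>
    ordered_group (@binop L N op) (@lt L N) ->
    is_subgroup (@binop L N op) (fun x => sat phi (scons x v)) ->
    trivial_subset (@binop L N op) (fun x => sat phi (scons x v)) \/
    full_subset (fun x => sat phi (scons x v))).
Proof.
apply: uniform_imp; first exact: uniform_ordered_group.
apply: uniform_imp.
  pose P (N : structure L) (v : 'I_n -> N) :=
    [/\ (exists x, sat phi (scons x v)) &
      (forall x y, sat phi (scons x v) -> sat phi (scons y v) ->
                   sat phi (scons (binop op x y) v)) /\
      (forall x y, sat phi (scons x v) -> is_identity (binop op) (binop op x y) ->
                   sat phi (scons y v))].
  apply: (@uniform_ext L n P); first by move=> N v; split=> [[? [? ?]]|[]].
  apply: uniform_and; first by apply: uniform_exists; apply: uniform_mem; exact: uniform_var.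
  apply: uniform_and; do 2 apply: uniform_forall; apply: uniform_imp;
    try (by apply: uniform_mem; exact: uniform_var); apply: uniform_imp.
  - by apply: uniform_mem; exact: uniform_var.
  - by apply: uniform_mem; apply: uniform_binop; exact: uniform_var.
  - by apply: uniform_is_identity; apply: uniform_binop; exact: uniform_var.
  - by apply: uniform_mem; exact: uniform_var.
apply: uniform_or; last by apply: uniform_forall; apply: uniform_mem; exact: uniform_var.
apply: uniform_forall; apply: uniform_iff; first by apply: uniform_mem; exact: uniform_var.
by apply: uniform_is_identity; exact: uniform_var.
Qed.

(** * O-minimalistic ordered groups *)

Section OMinimalistic.
Variables (L : language) (op : funsym L 2) (G : structure L).
Hypotheses (hmin : o_minimalistic G)
           (hgrp : ordered_group (@binop L G op) (@lt L G)).

Lemma definable_subgroup_trivial_or_full (H : G -> Prop) :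
  definable H -> is_subgroup (@binop L G op) H ->
  trivial_subset (@binop L G op) H \/ full_subset H.
Proof.
move=> [n [phi [a Hphi]]].
have -> : H = fun x => sat phi (scons x a).
  by apply: functional_extensionality => x; apply: propositional_extensionality.
apply: (o_minimalistic_transfer hmin (uniform_subgroup_dichotomy op phi)) => // N v hN hog.
by apply: o_minimal_definable_subgroup => //; exists n, phi, v.
Qed.

(** The centralizer C of a contains a. If it is trivial, then a is the identity
    and commutes with everything; if it is full, a is central. *)
Lemma o_minimalistic_commutative : commutative (@binop L G op).
Proof.
have [_ [opA [e [he _]]] _] := hgrp.
move=> a b; pose C x := binop op x a = binop op a x.
have defC : definable C.
  pose P (N : structure L) (v : 'I_2 -> N) :=
    binop op (v ord0) (v (lift ord0 ord0)) = binop op (v (lift ord0 ord0)) (v ord0).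
  apply: (uniform_definable (P := P) (a := fun=> a)).
    by apply: uniform_eq; do ?[exact: uniform_var|apply: uniform_binop].
  by move=> x; rewrite /P scons_zero scons_succ.
have subC : is_subgroup (binop op) C.
  split; first by exists a.
    by move=> x y Cx Cy; rewrite /C -opA Cy opA Cx opA.
  move=> x y Cx /(identity_uniq he) xy.
  apply: (op_injl hgrp he (z := x)); rewrite opA xy (he a).1.
  by rewrite /C in Cx; rewrite opA Cx -opA xy (he a).2.
case: (definable_subgroup_trivial_or_full defC subC) => [/(_ a) [/(_ erefl) ha _]|/(_ b)//].
by rewrite (ha b).1 (ha b).2.
Qed.

(** Commutativity makes the n-th powers a subgroup. It is not trivial: there is
    an element above the identity, and its n-th power is above the identity. *)
Lemma o_minimalistic_divisible : divisible (@binop L G op).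
Proof.
have [_ [_ [e [he _]]] _] := hgrp.
move=> n n_gt0; pose D (x : G) := exists y, iterop n (binop op) y y = x.
have DE x : D x <-> exists y, pow (binop op) e n y = x.
  by split=> -[y yx]; exists y; rewrite -yx (iterop_pow he).
have defD : definable D.
  pose P (N : structure L) (v : 'I_1 -> N) :=
    exists y, iterop n (binop op) y y = v ord0.
  apply: (uniform_definable (P := P) (a := fun=> e)).
    apply: uniform_exists; apply: uniform_eq; last exact: uniform_var.
    by apply: uniform_iterop => //; exact: uniform_var.
  by move=> x; rewrite /P scons_zero.
have powM x y := pow_op hgrp he n x y o_minimalistic_commutative.
have subD : is_subgroup (binop op) D.
  split; first by exists e; apply/DE; exists e; exact: pow_identity.
    by move=> _ _ /DE [x <-] /DE [y <-]; apply/DE; exists (binop op x y).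
  move=> _ z /DE [x <-] /(identity_uniq he) xz.
  have [y [xy _]] := inverse_exists hgrp he x.
  apply/DE; exists y; apply: (op_injl hgrp he (z := pow (binop op) e n x)).
  by rewrite -powM xy xz; exact: pow_identity.
case: (definable_subgroup_trivial_or_full defD subD) => // trivD.
have [_ [x ex]] := lt_no_endpoints e.
have [[irr _ _] _ _] := hgrp.
have /trivD /(identity_uniq he) xn : D (pow (binop op) e n x) by apply/DE; exists x.
by have := pow_mono hgrp he ex n_gt0; rewrite xn => /irr.
Qed.

End OMinimalistic.

Theorem theorem11p1 (L : language) (op : funsym L 2) (G : structure L)
    (hmin : o_minimalistic G) (hgrp : ordered_group (@binop L G op) (@lt L G)) :
  [/\ divisible (@binop L G op),
      commutative (@binop L G op) &
      forall H : G -> Prop, definable H -> is_subgroup (@binop L G op) H ->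
        trivial_subset (@binop L G op) H \/ full_subset H].
Proof.
split; first exact: o_minimalistic_divisible.
  exact: o_minimalistic_commutative.
move=> H; exact: definable_subgroup_trivial_or_full.
Qed.
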